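(* Let $G_i = P_{2i+3}$ for all $i \in \{0,1,2,3,4,5\}$. For every integer $k \ge 1$, let $i_j \in \{0,1,2,3,4,5\}$ for all $j \in \{1,\ldots,k\}$. Then $$GR(G_{i_1}, \ldots, G_{i_k}) = 3 + \max\{i_j : j \in \{1,\ldots,k\}\} + \sum_{j=1}^k i_j.$$
   Context: All graphs are finite, simple and undirected. $P_m$ and $K_m$ denote the path and the complete graph on $m$ vertices, respectively. A Gallai coloring is a coloring of the edges of a complete graph with no rainbow triangle, i.e. no triangle whose three edges have pairwise different colors. A Gallai $k$-coloring of $K_N$ is a Gallai coloring $c: E(K_N) \to \{1,\ldots,k\}$ (with colors from a set of $k$ colors; not every color needs to appear). For an integer $k \ge 1$ and graphs $H_1,\ldots,H_k$, the Gallai-Ramsey number $GR(H_1,\ldots,H_k)$ is the least integer $N$ such that every Gallai $k$-coloring of $K_N$ contains a monochromatic copy of $H_j$ in color $j$ (a not necessarily induced subgraph isomorphic to $H_j$, all of whose edges have color $j$) for some $j \in \{1,\ldots,k\}$. *)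

(* Defs.v *)
From mathcomp Require Import all_boot.
Set Implicit Arguments.
Unset Strict Implicit.
Unset Printing Implicit Defensive.

Record sgraph := SGraph {
  vertex :> finType;
  adj : rel vertex;
  adj_sym : symmetric adj;
  adj_irrefl : irreflexive adj
}.

Section PathGraph.
Variable m : nat.

Definition path_adj : rel 'I_m := fun x y => (x.+1 == y) || (y.+1 == x).

Lemma path_adj_sym : symmetric path_adj.
Proof. by move=> x y; rewrite /path_adj orbC. Qed.

Lemma path_adj_irrefl : irreflexive path_adj.
Proof. by move=> x; rewrite /path_adj orbb eqn_leq ltnn. Qed.

(* Here m counts vertices, not edges. *)
Definition path_graph : sgraph := SGraph path_adj_sym path_adj_irrefl.

End PathGraph.

(* The edge joining distinct vertices x and y of K_N is the set [set x; y].
   A coloring is given as a total function on subsets of 'I_N; every predicate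
   below reads it only at two-element subsets, so its other values are
   irrelevant. The colors 1, ..., k are represented by the elements of 'I_k. *)
Definition edge_coloring (N k : nat) := {set 'I_N} -> 'I_k.

Definition rainbow_triangle N k (c : edge_coloring N k) (x y z : 'I_N) : bool :=
  uniq [:: x; y; z] && uniq [:: c [set x; y]; c [set y; z]; c [set x; z]].

Definition gallai_coloring N k (c : edge_coloring N k) : Prop :=
  forall x y z : 'I_N, ~~ rainbow_triangle c x y z.

(* The copy need not be induced: nothing is required of non-adjacent pairs. *)
Definition monochromatic_copy N k (c : edge_coloring N k) (H : sgraph)
    (j : 'I_k) : Prop :=
  exists2 f : H -> 'I_N, injective f &
    forall u v : H, adj u v -> c [set f u; f v] = j.

Definition gallai_ramsey_property k (H : 'I_k -> sgraph) (N : nat) : Prop :=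
  forall c : edge_coloring N k, gallai_coloring c ->
    exists j : 'I_k, monochromatic_copy c (H j) j.

(* GR(H_1, ..., H_k) = N, stated as a relation because the existence of such
   an N is not built into the definition. *)
Definition is_gallai_ramsey_number k (H : 'I_k -> sgraph) (N : nat) : Prop :=
  gallai_ramsey_property H N /\
  forall M : nat, gallai_ramsey_property H M -> N <= M.

(* Main.v *)
Require Import Defs.
From mathcomp Require Import all_boot.
From mathcomp Require Import zify.

(** Write [m_j] for [i j], so that the [j]-th path has [2 m_j + 3] vertices.

    Lower bound.  Order the vertices and let each edge take a colour attached
    to its larger end: the first [2 m_j0 + 2] vertices get a colour [j0] with
    [m_j0] maximal, and then every other colour [j] gets [m_j] vertices.  The
    edges of colour [j <> j0] are covered by [m_j] vertices, whereas a path on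
    [2 m_j + 3] vertices has [m_j + 1] disjoint edges.

    Upper bound ([gallai_paths_upper]).  Let [V] be Gallai coloured without a
    path on [2 m_j + 3] vertices in colour [j], for all [j]; by induction on
    [V], it has at most [2 + max m + sum m] vertices.  By Gallai's theorem
    ([gallai_disconnected]) there are colours [r], [b], say with
    [m_b <= m_r], such that the components of the graph of all other colours
    partition [V] into at least two parts, and all edges between two parts have
    the same colour, [r] or [b].  Call them red and blue.

    Suppose that a part has at least [m_r + 2] vertices.  Alternating paths
    show that it has at most [m_r] red and [m_b] blue neighbours.  Deleting all
    of them, the bounds [m_r] and [m_b] drop by the number of deleted
    vertices, since a path inside the part could be prolonged through the
    deleted vertices; the induction hypothesis for the part concludes
    ([big_part]).

    Otherwise every part has more than [m_r] red or more than [m_b] blue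
    neighbours.  Recolour its inside red or blue accordingly.  In the
    resulting two-coloured complete graph, the theorem of Gerencser and Gyarfas
    ([two_color_paths]) gives a red path on [2 m_r + 3] vertices or a blue one
    on [2 m_b + 3].  Exchange arguments show that such a path with the
    fewest recoloured edges has none ([inside_edges_removable]), so it is a path of the
    original colouring ([not_all_parts_small]).

    The theorem on two colours is proved by alternating between a longest
    path of one colour and the vertices outside it. *)

Set Implicit Arguments.
Unset Strict Implicit.
Unset Printing Implicit Defensive.

(** * Paths as duplicate-free sequences *)

Section Paths.
Variable T : finType.
Implicit Types (e : rel T) (V : {set T}) (s : seq T).

Definition path_in e V s := [&& uniq s, sorted e s & all [in V] s].

Definition has_path e V n := [exists t : n.-tuple T, path_in e V t].

Lemma has_pathP e V n :
  reflect (exists2 s, path_in e V s & size s = n) (has_path e V n).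
Proof.
apply: (iffP existsP) => [[t tP]|[s sP <-]]; first by exists t; rewrite ?size_tuple.
by exists (in_tuple s).
Qed.

Lemma has_path_leq e V m n : m <= n -> has_path e V n -> has_path e V m.
Proof.
move=> le_mn /has_pathP[s /and3P[us ss /allP sV] sz].
apply/has_pathP; exists (take m s); last by rewrite size_takel // sz.
rewrite /path_in take_uniq // take_sorted //=.
by apply/allP => x /mem_take /sV.
Qed.

Lemma has_path_sub e e' V V' n :
    {in V &, subrel e e'} -> V \subset V' ->
  has_path e V n -> has_path e' V' n.
Proof.
move=> ee' /subsetP VV' /has_pathP[s /and3P[us ss sV] sz].
apply/has_pathP; exists s => //; rewrite /path_in us /=.
rewrite (sub_in_sorted (P := [in V]) (e := e)) //=.
by apply: sub_all sV => x /VV'.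
Qed.

Lemma path_in_size e V s : path_in e V s -> size s <= #|V|.
Proof.
case/and3P=> us _ /allP sV; rewrite cardE uniq_leq_size // => x /sV.
by rewrite mem_enum.
Qed.

Lemma longest_path e V :
  exists2 s, path_in e V s & forall s', path_in e V s' -> size s' <= size s.
Proof.
have ex0 : exists n, has_path e V n.
  by exists 0; apply/has_pathP; exists [::].
have le_card n : has_path e V n -> n <= #|V|.
  by case/has_pathP=> s /path_in_size + <-.
case: (ex_maxnP ex0 le_card) => n /has_pathP[s sP <-] max_s.
by exists s => // s' s'P; apply: max_s; apply/has_pathP; exists s'.
Qed.

Lemma not_path_split (r : rel T) x p :
  ~~ path r x p -> exists p1 a b p2, x :: p = p1 ++ a :: b :: p2 /\ ~~ r a b.
Proof.
elim: p x => //= y p IH x; rewrite negb_and.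
case/orP=> [nr|/IH[p1 [a [b [p2 [-> nr]]]]]]; first by exists [::], x, y, p.
by exists (x :: p1), a, b, p2.
Qed.

(** A vertex cover of a path has about half of its vertices, and more if it
    contains an end; read backwards, a set that is too small misses two
    consecutive vertices of the path. *)
Lemma cover_count (U : pred T) x p :
    path (fun a b => U a || U b) x p ->
  size (x :: p) + U x + U (last x p) <= (count U (x :: p)).*2.+1.
Proof.
elim: p x => [|y p IH] x /=; first by case: (U x).
by case/andP=> Uxy /IH /= {IH}; move: Uxy; case: (U x); case: (U y); lia.
Qed.

Lemma path_in_rev e V s : symmetric e -> path_in e V (rev s) = path_in e V s.
Proof.
move=> se; rewrite /path_in rev_uniq all_rev rev_sorted.
by congr [&& _, _ & _]; apply: eq_sorted => a b.
Qed.
End Paths.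

(** * Alternating around a longest path

    Throughout this part [P] is a longest red path and [Y] lies outside it.
    By maximality no vertex of [Y] is red to an end of [P], nor to two
    consecutive vertices of [P].  The relation [H] keeps only the non-red
    edges between [P] and [Y]; the goal is an [H]-path through all of [Y]. *)

Section Alternate.
Variables (T : finType) (red : rel T) (V Y : {set T}) (x0 : T) (p : seq T).
Hypothesis red_sym : symmetric red.
Let P := x0 :: p.
Hypothesis P_path : path_in red V P.
Hypothesis P_max : forall s, path_in red V s -> size s <= size P.
Hypothesis YV : Y \subset V.
Hypothesis YP : {in Y, forall y, y \notin P}.

Definition nonred : rel T := fun x y => (x != y) && ~~ red x y.
Let H : rel T := fun x y => nonred x y && ((x \in Y) (+) (y \in Y)).
Let W := [set z in P] :|: Y.

Let H_sym : symmetric H.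
Proof. by move=> a b; rewrite /H /nonred eq_sym red_sym addbC. Qed.

Let WV : W \subset V.
Proof.
have /and3P[_ _ /allP PV] := P_path.
rewrite subUset YV andbT; apply/subsetP => z; rewrite inE; exact: PV.
Qed.

Let H_PY a y : a \in P -> y \in Y -> ~~ red a y -> H a y.
Proof.
move=> aP yY nr; rewrite /H /nonred nr yY andbT.
case aY: (a \in Y); first by rewrite (negPf (YP aY)) in aP.
by rewrite !andbT; apply: contraFneq aY => ->.
Qed.

Let H_head y : y \in Y -> H x0 y.
Proof.
move=> yY; apply: H_PY => //; first by rewrite inE eqxx.
apply/negP => r; have /and3P[uP sP aP] := P_path.
suff /P_max : path_in red V (y :: P) by rewrite /= ltnn.
apply/and3P; split; first by rewrite cons_uniq (YP yY).
  by rewrite /= red_sym r.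
by rewrite -cat1s all_cat aP /= (subsetP YV).
Qed.

Let H_last y : y \in Y -> H (last x0 p) y.
Proof.
move=> yY; apply: H_PY => //; first by rewrite mem_last.
apply/negP => r; have /and3P[uP sP aP] := P_path.
suff /P_max : path_in red V (rcons P y) by rewrite size_rcons ltnn.
apply/and3P; split; first by rewrite rcons_uniq (YP yY).
  by rewrite /= rcons_path r [path _ _ _]sP.
by rewrite all_rcons aP andbT; apply: (subsetP YV).
Qed.

Let H_pair p1 a b p2 y :
  P = p1 ++ a :: b :: p2 -> y \in Y -> H y a || H y b.
Proof.
move=> eP yY; rewrite ![H y _]H_sym.
have aP : a \in P by rewrite eP mem_cat inE eqxx orbT.
have bP : b \in P by rewrite eP mem_cat !inE eqxx !orbT.
case ra: (red a y); last by rewrite H_PY // ra.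
case rb: (red b y); last by rewrite [H b y]H_PY ?rb ?orbT.
have /and3P[uP sP aV] := P_path.
suff /P_max : path_in red V (p1 ++ a :: y :: b :: p2).
  by rewrite eP !size_cat /= !addnS ltnn.
have perm_s : perm_eq (p1 ++ a :: y :: b :: p2) (y :: P).
  by rewrite eP -!(cat_rcons a) -(cat1s y (b :: p2)) perm_catCA.
rewrite /path_in (perm_uniq perm_s) (perm_all _ perm_s) cons_uniq (YP yY) uP.
have -> : all [in V] (y :: P) by apply/andP; split; first exact: (subsetP YV).
rewrite /= andbT.
move: sP; rewrite eP; case: p1 {eP perm_s} => [|c p1] /=.
  by rewrite ra (red_sym y) rb /= => /andP[_ ->].
by rewrite !cat_path /= ra (red_sym y) rb => /and4P[-> -> _ ->].
Qed.

(* Two consecutive vertices of P outside U serve every y in Y: each y has an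
   H-edge to one of them. *)
Let free_pair (U : pred T) :
    (count U P).*2.+1 < size P + U x0 + U (last x0 p) ->
  exists a b, [/\ a \in P, b \in P, a != b, ~~ U a /\ ~~ U b
                & forall y, y \in Y -> H y a || H y b].
Proof.
move=> lt; have /not_path_split[p1 [a [b [p2 [eP]]]]] :
    ~~ path (fun a b => U a || U b) x0 p.
  by apply/negP => /cover_count; rewrite leqNgt lt.
rewrite negb_or => /andP[Ua Ub]; have /and3P[uP _ _] := P_path.
exists a, b; rewrite Ua Ub [P]eP !mem_cat !inE !eqxx !orbT; split=> //.
  by move: uP; rewrite [P]eP cat_uniq => /and3P[_ _] /=; rewrite inE negb_or -andbA => /andP[].
by move=> y; apply: H_pair eP.
Qed.

Let count_alt y q :
  path H y q -> count (fun z => z \notin Y) q = (size q + (y \in Y))./2.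
Proof.
elim: q y => [|z q IH] y /=; first by case: (y \in Y).
case/andP=> /andP[_ yz] /IH ->.
by move: yz; case: (y \in Y); case: (z \in Y) => //= _; rewrite ?addn0 ?addn1; lia.
Qed.

Let last_alt y q : path H y q -> (last y q \in Y) = (y \in Y) (+) odd (size q).
Proof.
elim: q y => [|z q IH] y /=; first by rewrite addbF.
case/andP=> /andP[_ yz] /IH ->.
by move: yz; case: (y \in Y); case: (z \in Y); case: (odd _).
Qed.

(* An H-path with m.+1 vertices in Y, both ends included, and m in P. *)
Let alt m y q := [/\ y \in Y, path_in H W (y :: q) & size q = m.*2].

Let alt_last m y q : alt m y q -> last y q \in Y.
Proof.
by case=> yY /and3P[_ /= pq _] sq; rewrite last_alt // yY sq odd_double.
Qed.

Let count_used m y q : alt m y q -> count (mem (y :: q)) P <= m.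
Proof.
case=> yY /and3P[us pq _] sq; have /and3P[uP _ _] := P_path.
have := count_alt pq; rewrite sq yY addn1 -uphalfE uphalf_double => <-.
rewrite -(size_filter _ P) -(size_filter _ q); apply: uniq_leq_size; first exact: filter_uniq.
move=> z; rewrite !mem_filter => /andP[zs zP].
have zY : z \notin Y by apply: contraL zP; apply: YP.
by rewrite zY /=; move: zs; rewrite inE => /predU1P[ez|//]; rewrite ez yY in zY.
Qed.

(* A cycle can be opened next to any neighbour z of v, which gains v. *)
Let open_cycle v z c :
    cycle H c -> uniq c -> all [in W] c -> v \in W ->
    v \notin c -> z \in c -> H v z ->
  exists2 q, path_in H W (v :: q) & size q = size c.
Proof.
move=> cc uc aW vW vc zc vz; have [i c' ec] := rot_to zc.
exists (rot i c); last exact: size_rot.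
rewrite /path_in /= mem_rot vc rot_uniq uc vW /= (eq_all_r (mem_rot i c)) aW andbT.
rewrite -(rot_cycle i) in cc; move: cc; rewrite ec /= rcons_path vz.
by case/andP.
Qed.

Let used_lt m y q : alt m y q -> m.+1 < #|Y| -> exists2 y', y' \in Y & y' \notin y :: q.
Proof.
case=> yY /and3P[us pq _] sq lt.
case: (pickP (fun z => (z \in Y) && (z \notin y :: q))) => [y' /andP[]|none].
  by exists y'.
have sub : {subset enum Y <= filter [in Y] (y :: q)}.
  move=> z; rewrite mem_enum => zY; rewrite mem_filter [[in Y] z]zY.
  by have := none z; rewrite zY => /negbFE ->.
have := uniq_leq_size (enum_uniq _) sub; rewrite -cardE size_filter /= yY.
have := count_alt pq; rewrite sq yY addn1 -uphalfE uphalf_double.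
have : count [in Y] q + count (fun z => z \notin Y) q = size q := count_predC [in Y] q.
by rewrite sq; lia.
Qed.

Let in_WP z : z \in P -> z \in W. Proof. by rewrite !inE => ->. Qed.
Let in_WY z : z \in Y -> z \in W. Proof. by rewrite !inE => ->; rewrite orbT. Qed.

Let alt_rev m y q : alt m y q -> exists2 q', alt m (last y q) q' & rev (y :: q) = last y q :: q'.
Proof.
move=> h; have ly := alt_last h; case: h => yY pq sq.
have e : rev (y :: q) = last y q :: behead (rev (y :: q)).
  by rewrite lastI rev_rcons.
exists (behead (rev (y :: q))) => //; split=> //; first by rewrite -e path_in_rev.
by rewrite size_behead size_rev.
Qed.

Let alt_extend m y q x y' :
    alt m y q -> x \in P -> x \notin y :: q -> y' \in Y -> y' \notin y :: q ->
    H (last y q) x -> H x y' ->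
  exists y1 q1, alt m.+1 y1 q1.
Proof.
case=> yY /and3P[us pq aW] sq xP xs y'Y y's h1 h2.
exists y, (rcons (rcons q x) y'); split=> //; last by rewrite !size_rcons sq doubleS.
have xy' : y' != x by apply: contraTneq xP => <-; apply: YP.
rewrite /path_in -!rcons_cons !rcons_uniq us mem_rcons inE negb_or xy' y's xs /=.
rewrite !rcons_path last_rcons h1 h2 [path _ _ _]pq /=.
by rewrite !all_rcons /= (in_WP xP) (in_WY y'Y) /= in_WY //=; case/andP: aW.
Qed.

(* If the end x0 of P is unused, it joins the path to a new y', since x0 is
   H-adjacent to all of Y.  Otherwise take an unused consecutive pair a, b
   with a adjacent to y'.  Either a continues the path at one of its ends, or
   both ends are adjacent to b, which closes a cycle through x0; opening the
   cycle at x0 attaches y'. *)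
Let alt_step m y q :
    alt m y q -> m.+1 < #|Y| -> m.*2 < size P -> exists y1 q1, alt m.+1 y1 q1.
Proof.
move=> h ltY ltP; have [y' y'Y y's] := used_lt h ltY.
have lY := alt_last h.
have [x0s|x0s] := boolP (x0 \in y :: q); last first.
  by apply: (alt_extend h _ x0s y'Y y's); rewrite ?inE ?eqxx ?H_head // H_sym H_head.
have cnt := count_used h.
have [|a [b [aP bP nab [Ua Ub] ab]]] := @free_pair (mem (y :: q)).
  apply: leq_trans (leq_addr _ _); rewrite [mem _ x0]x0s; move: (count _ P) (size P) cnt ltP => c sz; clear; lia.
wlog y'a : a b aP bP nab Ua Ub ab / H y' a.
  move=> W0; have /orP[] := ab _ y'Y; first exact: W0 Ub ab.
  by apply: (W0 b a) => //; [rewrite eq_sym|move=> z /ab; rewrite orbC].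
have ay' : H a y' by rewrite H_sym.
have [la|la] := boolP (H (last y q) a); first exact: alt_extend la ay'.
have [ya|ya] := boolP (H y a).
  have [q' h' e'] := alt_rev h.
  have mem' z : (z \in last y q :: q') = (z \in y :: q) by rewrite -e' mem_rev.
  have l' : last (last y q) q' = y.
    by rewrite -[LHS]/(last y (last y q :: q')) -e' rev_cons last_rcons.
  by apply: (alt_extend h' aP _ y'Y _ _ ay'); rewrite ?mem' ?l'.
have yY : y \in Y by case: h.
have := ab _ lY; rewrite (negPf la) /= => lb.
have := ab _ yY; rewrite (negPf ya) /= => yb.
have /and3P[us pq aW] : path_in H W (y :: q) by case: h.
have cc : cycle H (b :: y :: q).
  by rewrite /= rcons_path [path _ _ _]pq lb H_sym yb.
have uc : uniq (b :: y :: q) by rewrite cons_uniq Ub us.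
have bW : all [in W] (b :: y :: q) by rewrite /= in_WP // -[_ && _]/(all _ (y :: q)).
have y'c : y' \notin b :: y :: q.
  by rewrite inE negb_or y's andbT; apply: contraTneq bP => <-; apply: YP.
have x0c : x0 \in b :: y :: q by rewrite inE x0s orbT.
have [|q1 q1P sq1] := open_cycle cc uc bW (in_WY y'Y) y'c x0c.
  by rewrite H_sym H_head.
exists y', q1; split=> //; rewrite sq1 /=; case: h => _ _ ->.
by rewrite doubleS.
Qed.

Let alt_cover m : m < #|Y| -> m.*2 <= (size P).+1 -> exists y q, alt m y q.
Proof.
elim: m => [|m IH] ltY leP.
  have /card_gt0P[y yY] := ltY; exists y, [::]; split=> //.
  by rewrite /path_in /= in_WY.
have [| |y [q h]] := IH; [lia|lia|].
by apply: (alt_step h) => //; lia.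
Qed.

Let H_has_path s : path_in H W s -> has_path nonred V (size s).
Proof.
move=> sP; apply: (has_path_sub (e := H) _ WV).
  by move=> a b _ _ /andP[].
by apply/has_pathP; exists s.
Qed.

(** The alternating path through [Y] is prolonged at both ends by an unused
    consecutive pair.  If both ends only see the same vertex [w] of that pair,
    then [w] closes a cycle.  An unused vertex with a neighbour on the cycle
    exists by counting: otherwise the cycle would contain both ends of [P]
    and one of every two consecutive vertices, which is too many. *)
Lemma nonred_path_odd : 0 < #|Y| -> #|Y|.*2 <= size P -> has_path nonred V (#|Y|.*2).+1.
Proof.
move=> Y0 leP; have eY := prednK Y0.
have [| |y [q h]] := @alt_cover #|Y|.-1; [lia|lia|].
move: eY; set m := #|Y|.-1 in h * => eY; rewrite -eY in leP *.
have cnt := count_used h; have lY := alt_last h.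
have [yY sP sq] := h; have /and3P[us pq aW] := sP.
have [|a [b [aP bP nab [Ua Ub] ab]]] := @free_pair (mem (y :: q)).
  rewrite -addnA; apply: leq_trans (leq_addr _ _).
  by move: (count _ P) (size P) cnt leP => c sz; clear; lia.
have both u v : u \in P -> v \in P -> u != v -> u \notin y :: q -> v \notin y :: q ->
    H y u -> H (last y q) v -> has_path nonred V (m.+1.*2).+1.
  move=> uP vP nuv us' vs yu lv.
  have -> : (m.+1.*2).+1 = size (u :: rcons (y :: q) v).
    by rewrite /= size_rcons sq doubleS.
  apply: H_has_path; apply/and3P; split.
  - by rewrite cons_uniq mem_rcons inE negb_or nuv us' rcons_uniq vs.
  - by rewrite /= H_sym yu rcons_path lv [path _ _ _]pq.
  have : all [in W] (rcons (y :: q) v) by rewrite all_rcons aW andbT in_WP.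
  by move=> aW'; apply/andP; split; first exact: in_WP.
have {both}[//|[w [wP Uw yw lw]]] : (has_path nonred V (m.+1.*2).+1) \/
   exists w, [/\ w \in P, w \notin y :: q, H y w & H (last y q) w].
  have /orP[ya|yb] := ab _ yY; have /orP[la|lb] := ab _ lY.
  - by right; exists a.
  - by left; apply: (both a b).
  - by left; apply: (both b a) => //; rewrite eq_sym.
  - by right; exists b.
pose c := w :: y :: q.
have cc : cycle H c by rewrite /c /= rcons_path [path _ _ _]pq lw H_sym yw.
have uc : uniq c by rewrite cons_uniq Uw us.
have cW : all [in W] c by apply/andP; split; first exact: in_WP.
suff [v [z [vP vc zc vz]]] : exists v z, [/\ v \in P, v \notin c, z \in c & H v z].
  have [q1 /H_has_path] := open_cycle cc uc cW (in_WP vP) vc zc vz.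
  by move=> hp sz; move: hp; rewrite [size _]/= sz /c /= sq.
have yc : y \in c by rewrite !inE eqxx orbT.
have [x0c|x0c] := boolP (x0 \in c); last first.
  by exists x0, y; split=> //; [rewrite inE eqxx|apply: H_head].
have [lc|lc] := boolP (last x0 p \in c); last first.
  by exists (last x0 p), y; split=> //; [rewrite mem_last|apply: H_last].
have cntc : count (mem c) P <= m.+1.
  apply: leq_trans (_ : count (pred1 w) P + count (mem (y :: q)) P <= _).
    rewrite -count_predUI; apply: leq_trans (leq_addr _ _).
    by apply: sub_count => z; rewrite /= [_ \in c]inE.
  have /and3P[uP _ _] := P_path; rewrite count_uniq_mem // wP.
  by rewrite -add1n leq_add2l.
have [|v [v' [vP v'P _ [Uv Uv'] vv']]] := @free_pair (mem c).
  rewrite [mem _ x0]x0c [mem _ (last _ _)]lc.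
  by move: (count _ P) (size P) cntc leP => n sz; clear; lia.
by have /orP[yv|yv] := vv' _ yY; [exists v, y|exists v', y]; rewrite H_sym.
Qed.

(** Here [P] is one vertex too short for two prolongations, but one end of the
    alternating path can still be prolonged. *)
Lemma nonred_path_even : #|Y|.*2 = (size P).+1 -> has_path nonred V (#|Y|.*2).
Proof.
move=> eY; have Y0 : 0 < #|Y| by case: #|Y| eY.
have [| |y [q h]] := @alt_cover #|Y|.-1; first by rewrite prednK.
  by rewrite -eY leq_double leq_pred.
have {}eY : (#|Y|.-1).*2.+1 = size P.
  by apply: succn_inj; rewrite -eY -doubleS prednK.
have -> : #|Y|.*2 = (#|Y|.-1).*2.+2 by rewrite -doubleS prednK.
move: eY h; set m := #|Y|.-1 => eY h.
have cnt := count_used h; have [yY sP sq] := h; have /and3P[us pq aW] := sP.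
suff [v [vP vs yv]] : exists v, [/\ v \in P, v \notin y :: q & H y v].
  have -> : m.*2.+2 = size (v :: y :: q) by rewrite /= sq.
  apply: H_has_path; rewrite /path_in cons_uniq vs us /= H_sym yv [path _ _ _]pq.
  by rewrite in_WP.
have [x0s|x0s] := boolP (x0 \in y :: q); last first.
  by exists x0; split=> //; [rewrite inE eqxx|rewrite H_sym H_head].
have [|v [v' [vP v'P _ [Uv Uv'] vv']]] := @free_pair (mem (y :: q)).
  apply: leq_trans (leq_addr _ _); rewrite [mem _ x0]x0s.
  by move: (count _ P) (size P) cnt eY => n sz; clear; lia.
by have /orP[yv|yv] := vv' _ yY; [exists v|exists v'].
Qed.

End Alternate.

(** * Two-coloured complete graphs *)

Lemma exists_subset (T : finType) (A : {set T}) n :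
  n <= #|A| -> exists2 B : {set T}, B \subset A & #|B| = n.
Proof.
move=> le_n; exists [set z in take n (enum A)].
  by apply/subsetP => z; rewrite inE => /mem_take; rewrite mem_enum.
rewrite cardsE; have /card_uniqP -> : uniq (take n (enum A)).
  by rewrite take_uniq ?enum_uniq.
by rewrite size_takel // -cardE.
Qed.

Section TwoColors.
Variables (T : finType) (V : {set T}).

Lemma path_compl (red : rel T) s n :
    symmetric red -> path_in red V s ->
    (forall s', path_in red V s' -> size s' <= size s) ->
    0 < n -> n + size s <= #|V| ->
  (n.*2 <= size s -> has_path (nonred red) V n.*2.+1) /\
  (n.*2 = (size s).+1 -> has_path (nonred red) V n.*2).
Proof.
move=> red_sym sP max_s n0 leV.
have [x0 [p es]] : exists x0 p, s = x0 :: p.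
  case: s sP max_s leV => [|x0 p] _ max_s leV; last by exists x0, p.
  have /card_gt0P[x xV] : 0 < #|V| by rewrite (leq_trans n0) // -[n]addn0.
  by have := max_s [:: x]; rewrite /path_in /= xV => /(_ isT).
rewrite {s}es in sP max_s leV *.
have /and3P[us _ /allP sV] := sP.
have [Y YA cY] : exists2 Y : {set T}, Y \subset V :\: [set z in x0 :: p] & #|Y| = n.
  apply: exists_subset; rewrite cardsD.
  have -> : V :&: [set z in x0 :: p] = [set z in x0 :: p].
    by apply/setIidPr/subsetP => z; rewrite inE; apply: sV.
  by rewrite cardsE (card_uniqP us) leq_subRL ?(addnC _ n) // (leq_trans _ leV) ?leq_addl.
have YV : Y \subset V by apply: subset_trans YA (subsetDl _ _).
have YP : {in Y, forall y, y \notin x0 :: p}.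
  by move=> y /(subsetP YA); rewrite !inE => /andP[].
rewrite -cY in n0 *; split=> h.
  exact: (nonred_path_odd red_sym sP).
exact: (nonred_path_even red_sym sP).
Qed.

(** If a third of the vertices lie outside a longest path, then the
    complementary colour has a strictly longer one; the size of the outside
    set is chosen according to the parity of the path. *)
Lemma balanced_path (red : rel T) s :
    symmetric red -> path_in red V s ->
    (forall s', path_in red V s' -> size s' <= size s) ->
    0 < size s -> size s + uphalf (size s) <= #|V| ->
  has_path (nonred red) V (size s).+1.
Proof.
move=> red_sym sP max_s s0 leV.
have [||h1 h2] := path_compl (n := uphalf (size s)) red_sym sP max_s.
- by case: (size s) s0 => // k _; rewrite uphalfE.
- by rewrite addnC.
have [od|ev] := boolP (odd (size s)).
  have e : (uphalf (size s)).*2 = (size s).+1 by rewrite uphalfE halfK /= od subn0.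
  by rewrite e in h2; apply: h2.
have e : (uphalf (size s)).*2 = size s by rewrite uphalfE halfK /= ev subn1.
by rewrite e leqnn in h1; apply: h1.
Qed.

(** The Ramsey number of two odd paths (Gerencser and Gyarfas).  Either the
    longest red path [s] is long enough to alternate [b.+1] outside vertices
    with it, which gives the blue path; or it is so short that
    [balanced_path] applies to red, giving a longer blue path, and then again
    to blue, giving a red path longer than [s]. *)
Theorem two_color_paths (red blue : rel T) r b :
    symmetric red -> symmetric blue ->
    {in V &, forall x y, x != y -> red x y || blue x y} ->
    b <= r -> r.*2 + b + 3 <= #|V| ->
  has_path red V (r.*2 + 3) || has_path blue V (b.*2 + 3).
Proof.
move=> red_sym blue_sym rb le_br leV; apply/norP => -[noR noB].
have nr n : has_path (nonred red) V n -> has_path blue V n.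
  apply: has_path_sub => // x y xV yV /andP[nxy /negPf nxr].
  by have := rb x y xV yV nxy; rewrite nxr.
have nb n : has_path (nonred blue) V n -> has_path red V n.
  apply: has_path_sub => // x y xV yV /andP[nxy /negPf nxr].
  by have := rb x y xV yV nxy; rewrite nxr orbF.
have [s sP max_s] := longest_path red V.
have [s' s'P max_s'] := longest_path blue V.
have [x xV] : exists x, x \in V by apply/card_gt0P; lia.
have s1 : 0 < size s by apply: (max_s [:: x]); rewrite /path_in /= xV.
have s_lt : size s < r.*2 + 3.
  rewrite ltnNge; apply/negP => h; case/negP: noR.
  by apply: has_path_leq h _; apply/has_pathP; exists s.
have s'_lt : size s' < b.*2 + 3.
  rewrite ltnNge; apply/negP => h; case/negP: noB.
  by apply: has_path_leq h _; apply/has_pathP; exists s'.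
have [le_bs|lt_sb] := leqP (b.*2 + 2) (size s).
  have [||h _] := path_compl (n := b.+1) red_sym sP max_s; [by []|lia|].
  case/negP: noB; apply: nr.
  have -> : b.*2 + 3 = b.+1.*2.+1 by lia.
  by apply: h; lia.
have /nr/has_pathP[t tP st] : has_path (nonred red) V (size s).+1.
  by apply: balanced_path => //; clear -lt_sb leV le_br; lia.
have lt_s : size s < size s' by rewrite -st; apply: max_s'.
have /nb/has_pathP[t' t'P st'] : has_path (nonred blue) V (size s').+1.
  by apply: balanced_path => //; clear -lt_s s'_lt leV le_br; lia.
by have := max_s _ t'P; clear -st' lt_s; lia.
Qed.

End TwoColors.

(** * Counting the edges of a sequence inside a relation *)

Section Joins.
Variables (T : Type) (e : rel T).

Lemma sorted_join s u w q :
  sorted e (rcons s u ++ w :: q) = [&& sorted e (rcons s u), e u w & path e w q].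
Proof. by case: s => [|a s] //=; rewrite cat_path last_rcons. Qed.

Definition steps x p := count id (pairmap e x p).
Definition inner s := if s is x :: p then steps x p else 0.

Lemma inner_join s u w q :
  inner (rcons s u ++ w :: q) = inner (rcons s u) + e u w + steps w q.
Proof.
by case: s => [|a s] //=; rewrite /steps pairmap_cat count_cat last_rcons /= addnA.
Qed.

Lemma inner_rev s : symmetric e -> inner (rev s) = inner s.
Proof.
move=> se; elim: s => // a [//|b s] IH.
rewrite rev_cons rev_cons -cats1 -[[:: a]]/(a :: [::]) inner_join -rev_cons IH.
by rewrite /= /steps /= addn0 se addnC.
Qed.

Lemma inner0 s : (inner s == 0) = sorted (fun a b => ~~ e a b) s.
Proof.
case: s => // a s; elim: s a => // b s IH a /=.
by have := IH b; rewrite /= => <-; rewrite /steps /= addn_eq0 eqb0.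
Qed.
End Joins.

(** * Removing the edges inside parts from a path

    [sim] is an equivalence whose classes are the parts, [good] a relation
    between different parts that depends only on the part of each vertex, and
    [ty] selects parts that have more than [n] good neighbours. *)

Section Absorb.
Variables (T : finType) (V : {set T}) (good sim : rel T) (ty : pred T) (n : nat).
Hypothesis good_sym : symmetric good.
Hypothesis sim_refl : reflexive sim.
Hypothesis sim_sym : symmetric sim.
Hypothesis goodN : forall x y, good x y -> ~~ sim x y.
Hypothesis good_sim : forall x x' z, sim x x' -> good x z = good x' z.
Hypothesis ty_sim : forall x y, sim x y -> ty x = ty y.
Hypothesis ty_big : forall x, x \in V -> ty x -> n < #|[set z in V | good x z]|.

(** The colour [good] after all edges inside the parts selected by [ty] have
    been given that colour too. *)
Definition recolored : rel T :=
  fun x y => good x y || [&& x != y, sim x y & ty x].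
Let wide := recolored.

Lemma recolored_sym : symmetric wide.
Proof.
move=> x y; rewrite /wide /recolored good_sym eq_sym sim_sym.
by case h: (sim y x); rewrite // (ty_sim h).
Qed.

Let B x := [set z in V | good x z].

(* Let the edge x x' of s lie inside a part.  A good neighbour z of that part
   which is not on s, or is the last vertex of s, is inserted between x and x'
   while the last vertex is dropped.  If two consecutive vertices z, z' after
   x' are both good neighbours, reversing the stretch from x' to z replaces the
   edges x x' and z z' by the good edges x z and x' z'.  Each move lowers the
   number of inside edges.  The part of s before x is listed in reverse, so
   that the lemma also applies to rev s with x and x' exchanged. *)
Let improve s x a x' d :
    s = rev (x :: a) ++ x' :: d -> path_in wide V s -> sim x x' ->
  (exists s1, [/\ path_in wide V s1, size s1 = size s & inner sim s1 < inner sim s])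
  \/ [/\ path (fun y z => (y \notin B x) || (z \notin B x)) x' d,
         last x' d \notin B x & {subset B x <= s}].
Proof.
move=> es sP xx'.
have /and3P[us ss /allP sV] := sP.
have ss' := ss; rewrite es rev_cons sorted_join in ss'.
have /and3P[sa wxx pd] := ss'.
have inn_s : inner sim s = inner sim (rev (x :: a)) + 1 + steps sim x' d.
  by rewrite es rev_cons inner_join xx'.
have Bx z : z \in B x -> [/\ z \in V, good x z, good z x' & ~~ sim x z /\ ~~ sim z x'].
  rewrite inE => /andP[zV xz]; have x'z : good z x' by rewrite good_sym -(good_sim _ xx').
  by split; rewrite ?goodN.
case: (pickP (fun z => (z \in B x) && (z \notin rev (x :: a) ++ belast x' d))) =>
    [z /andP[zB zs]|none].
  have [zV xz zx' [nxz nzx]] := Bx z zB.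
  left; exists (rev (x :: a) ++ z :: belast x' d); split.
  - apply/and3P; split.
    + have perm : perm_eq (rev (x :: a) ++ z :: belast x' d)
                          (z :: (rev (x :: a) ++ belast x' d)).
        by rewrite -(cat1s z (belast x' d)) perm_catCA.
      rewrite (perm_uniq perm) cons_uniq zs /=.
      move: us; rewrite es (lastI x' d) -rcons_cat rcons_uniq.
      by case/andP.
    + rewrite rev_cons sorted_join sa /wide /recolored xz /=.
      have : path wide z (x' :: d) by rewrite /= {1}/wide /recolored zx'.
      by rewrite (lastI x' d) rcons_path => /andP[].
    + apply/allP => w; rewrite mem_cat inE => /or3P[h|/eqP->//|/mem_belast h].
        by apply: sV; rewrite es mem_cat h.
      by apply: sV; rewrite es mem_cat h orbT.
  - by rewrite es !size_cat /= size_belast.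
  - rewrite inn_s rev_cons inner_join -rev_cons (negPf nxz) addn0 -addnA ltn_add2l add1n ltnS.
    have <- : steps sim z (x' :: d) = steps sim x' d by rewrite /steps /= (negPf nzx).
    by rewrite (lastI x' d) /steps -cats1 pairmap_cat count_cat leq_addr.
have [hit|/not_path_split[p1 [z [z' [p2 [ed]]]]]] :=
    boolP (path (fun y z => (y \notin B x) || (z \notin B x)) x' d).
  right; split=> //.
    apply/negP => lB; have := none (last x' d); rewrite lB /= => /negbFE.
    by apply/negP; move: us; rewrite es (lastI x' d) -rcons_cat rcons_uniq => /andP[].
  move=> z zB; have := none z; rewrite zB /= => /negbFE; rewrite es !mem_cat.
  by case/orP=> [-> //|/mem_belast ->]; rewrite orbT.
rewrite negb_or !negbK => /andP[zB z'B].
have [_ xz _ [nxz _]] := Bx z zB; have [_ _ z'x' [_ nz'x']] := Bx z' z'B.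
have [t eM] : exists t, rcons p1 z = x' :: t.
  by case: p1 ed => [|c p1] /= [->]; [exists [::]|exists (rcons p1 z)].
have {}ed : x' :: d = rcons p1 z ++ z' :: p2 by rewrite cat_rcons.
have pM : path wide x' d = [&& sorted wide (rcons p1 z), wide z z' & path wide z' p2].
  by rewrite -sorted_join -ed.
have iM : steps sim x' d = inner sim (rcons p1 z) + sim z z' + steps sim z' p2.
  by rewrite -inner_join -ed.
left; exists (rev (x :: a) ++ rev (rcons p1 z) ++ z' :: p2); split.
- have perm : perm_eq (rev (x :: a) ++ rev (rcons p1 z) ++ z' :: p2) s.
    by rewrite es ed perm_cat2l perm_cat2r perm_rev.
  rewrite /path_in (perm_uniq perm) us (perm_all _ perm).
  rewrite rev_cons rev_rcons cat_cons sorted_join sa {1}/wide /recolored xz.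
  rewrite -[path _ _ _]/(sorted wide (z :: rev p1 ++ z' :: p2)) -cat_cons -rev_rcons.
  rewrite eM rev_cons sorted_join -rev_cons -eM.
  rewrite pM in pd; have /and3P[sM _ p2P] := pd.
  rewrite p2P {2}/wide /recolored good_sym z'x'.
  have -> : sorted wide (rev (rcons p1 z)).
    by rewrite rev_sorted (eq_sorted (e' := wide)) // => u v; rewrite recolored_sym.
  by rewrite andbT; apply/allP.
- by rewrite es ed !size_cat !size_rev.
- rewrite inn_s iM rev_cons rev_rcons cat_cons inner_join -rev_cons (negPf nxz).
  rewrite -[steps _ _ _]/(inner sim (z :: rev p1 ++ z' :: p2)) -cat_cons -rev_rcons.
  rewrite eM (rev_cons x') inner_join -(rev_cons x') -eM !(inner_rev _ sim_sym) sim_sym (negPf nz'x').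
  by rewrite !addn0 -addnA ltn_add2l add1n ltnS leq_add2r leq_addr.
Qed.

Let inside_edges_removable_rec k s :
    inner sim s <= k -> path_in wide V s -> size s = n.*2 + 3 ->
  has_path good V (n.*2 + 3).
Proof.
elim: k s => [|k IH] s le_k sP sz.
  apply/has_pathP; exists s => //; have /and3P[us ss sV] := sP.
  rewrite /path_in us sV andbT /=.
  move: le_k; rewrite leqn0 inner0; case: s ss {sP sz us sV} => // a s /=.
  elim: s a => // b s IH a /= /andP[+ /IH{}IH] /andP[nab /IH ->].
  by rewrite /wide /recolored (negPf nab) andbF orbF => ->.
have [z|nz] := leqP (inner sim s) k; first exact: IH z sP sz.
have {nz}nz : inner sim s != 0 by rewrite -lt0n (leq_ltn_trans _ nz).
have [a [x [x' [d [es xx']]]]] : exists a x x' d, s = rev (x :: a) ++ x' :: d /\ sim x x'.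
  move: nz; rewrite inner0; case: s {le_k sP sz} => // c s.
  move=> /not_path_split[p1 [x [x' [d [-> /negPn h]]]]].
  by exists (rev p1), x, x', d; rewrite rev_cons revK cat_rcons.
have decr s1 : path_in wide V s1 -> size s1 = size s -> inner sim s1 < inner sim s ->
    has_path good V (n.*2 + 3).
  by move=> s1P sz1 lt1; apply: (IH s1) => //; [rewrite -ltnS (leq_trans lt1)|rewrite sz1].
have [[s1 [s1P sz1 lt1]]|[hd ld Bs]] := improve es sP xx'; first exact: (decr s1).
have rP : path_in wide V (rev s) by rewrite (path_in_rev _ _ recolored_sym).
have er : rev s = rev (x' :: d) ++ x :: a by rewrite es rev_cat revK.
have x'x : sim x' x by rewrite sim_sym.
have [[s1 [s1P sz1 lt1]]|[ha la _]] := improve er rP x'x.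
  by apply: (decr s1); rewrite // ?sz1 ?size_rev // -(inner_rev s sim_sym).
have BE : B x' = B x by apply/setP => z; rewrite !inE (good_sim _ xx').
rewrite {}BE in ha la.
have /and3P[us ss sV] := sP.
have xV : x \in V by apply: (allP sV); rewrite es mem_cat mem_rev inE eqxx.
have NB y : sim x y -> y \notin B x.
  by move=> xy; rewrite inE; apply/negP => /andP[_ /goodN]; rewrite xy.
have tx : ty x.
  move: ss; rewrite es rev_cons sorted_join => /and3P[_ + _].
  by case/orP=> [/goodN|/and3P[]//]; rewrite xx'.
(* No move applies on either side of x x'.  The vertices outside B x then cover
   both stretches and contain both ends of each, so there are at least n + 3 of
   them, while more than n of the 2n + 3 vertices of s lie in B x. *)
have big := ty_big xV tx.
have c1 := cover_count hd; have c2 := cover_count ha.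
rewrite ld NB // in c1; rewrite la NB // in c2.
have sub : #|B x| <= count [in B x] s.
  rewrite -size_filter cardE; apply: uniq_leq_size; first exact: enum_uniq.
  by move=> z; rewrite mem_enum mem_filter => zB; rewrite zB Bs.
have tot : count [in B x] s + count (fun z => z \notin B x) s = size s :=
  count_predC [in B x] s.
exfalso; move: (count [in B x] s) sub tot sz => c.
rewrite es count_cat size_cat count_rev size_rev; move: big c1 c2; rewrite -/(B x) /=.
move: (count _ a) (count _ d) (size a) (size d) => ca cd na nd.
by clear; lia.
Qed.

(** A part with more than [n] good neighbours never needs its inside edges:
    a path on [n.*2 + 3] vertices with the fewest inside edges has none. *)
Lemma inside_edges_removable : has_path wide V (n.*2 + 3) -> has_path good V (n.*2 + 3).
Proof. by case/has_pathP=> s sP sz; apply: inside_edges_removable_rec sP sz. Qed.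

End Absorb.

(** * Prolonging a path through a complete bipartite graph *)

Section Extend.
Variables (T : finType) (e : rel T) (V A R : {set T}).
Hypothesis e_sym : symmetric e.
Hypotheses (AV : A \subset V) (RV : R \subset V) (dAR : [disjoint A & R]).
Hypothesis eAR : {in A & R, forall a z, e a z}.

(** Each vertex of [R] is followed by a new vertex of [A], so the room needed
    in [A] is [n] beyond the given path. *)
Lemma extend_path s n :
    path_in e A s -> 0 < size s -> size s + n <= #|A| -> n <= #|R| ->
  has_path e V (size s + n.*2).
Proof.
move=> sP s0 leA leR; have /and3P[us ss /allP sA] := sP.
suff ext k x p :
    path_in e V (x :: p) -> last x p \in A -> k <= #|A :\: [set y in x :: p]| ->
    k <= #|R :\: [set y in x :: p]| -> has_path e V (size (x :: p) + k.*2).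
  case: s s0 us ss sA leA {sP} => // x p _ us ss sA leA; apply: ext.
  - by rewrite /path_in us ss; apply/allP => y /sA /(subsetP AV).
  - by apply: sA; rewrite mem_last.
  - rewrite cardsD.
    have -> : A :&: [set y in x :: p] = [set y in x :: p].
      by apply/setIidPr/subsetP => y; rewrite inE; apply: sA.
    by rewrite cardsE (card_uniqP us) leq_subRL // (leq_trans (leq_addr n _)).
  - rewrite (_ : R :\: _ = R) //; apply/setDidPl; rewrite -setI_eq0.
    apply/eqP/setP => y; rewrite !inE; apply/negP => /andP[yR /sA yA].
    by have := disjointFr dAR yA; rewrite yR.
elim: k x p {s n sP s0 us ss sA leA leR} => [|k IH] x p sP lA kA kR.
  by rewrite addn0; apply/has_pathP; exists (x :: p).
have /card_gt0P[a aA'] := leq_ltn_trans (leq0n k) kA.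
have /card_gt0P[z zR'] := leq_ltn_trans (leq0n k) kR.
have [aA aN] : a \in A /\ a \notin x :: p by move: aA'; rewrite in_setD inE => /andP[].
have [zR zN] : z \in R /\ z \notin x :: p by move: zR'; rewrite in_setD inE => /andP[].
have naz : a != z by apply: contraTneq aA => ->; rewrite (disjointFl dAR zR).
have memE y : (y \in x :: rcons (rcons p z) a) = [|| y == a, y == z | y \in x :: p].
  by rewrite -rcons_cons mem_rcons inE -rcons_cons mem_rcons inE.
have /and3P[us ss sV] := sP.
have -> : size (x :: p) + k.+1.*2 = size (x :: rcons (rcons p z) a) + k.*2.
  by rewrite /= !size_rcons; clear; lia.
apply: IH.
- apply/and3P; split.
  + by rewrite -!rcons_cons !rcons_uniq mem_rcons in_cons negb_or naz aN zN.
  + by rewrite /= !rcons_path last_rcons eAR // e_sym eAR // [path _ _ _]ss.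
  + by rewrite -!rcons_cons !all_rcons sV (subsetP AV) ?(subsetP RV).
- by rewrite last_rcons.
- rewrite (cardsD1 a) aA' add1n ltnS in kA; apply: leq_trans kA (subset_leq_card _).
  apply/subsetP => y; rewrite in_setD1 !in_setD !in_set memE !negb_or => /and3P[-> -> yA].
  by rewrite yA /= !andbT; apply: contraTneq yA => ->; rewrite (disjointFl dAR zR).
- rewrite (cardsD1 z) zR' add1n ltnS in kR; apply: leq_trans kR (subset_leq_card _).
  apply/subsetP => y; rewrite in_setD1 !in_setD !in_set memE !negb_or => /and3P[-> -> yR].
  by rewrite yR /= !andbT; apply: contraTneq yR => ->; rewrite (disjointFr dAR aA).
Qed.
End Extend.

(** * Gallai partitions *)

Section Gallai.
Variables (T C : finType) (c : T -> T -> C).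
Hypothesis c_sym : forall x y, c x y = c y x.
Hypothesis c_gallai : forall x y z, x != y -> y != z -> x != z ->
  [|| c x y == c y z, c x y == c x z | c y z == c x z].
Implicit Types V : {set T}.

(** The edges inside [V] coloured neither [r] nor [b].  The components of this
    graph are the parts of a Gallai partition as soon as there are two. *)
Definition third_color V r b : rel T :=
  fun x y => [&& x \in V, y \in V, x != y, c x y != r & c x y != b].

Lemma third_color_sym V r b : symmetric (third_color V r b).
Proof. by move=> x y; rewrite /third_color c_sym eq_sym andbCA. Qed.

Lemma third_color_connect_sym V r b x y :
  connect (third_color V r b) x y = connect (third_color V r b) y x.
Proof. exact: (sym_connect_sym (third_color_sym V r b)). Qed.

Lemma third_color_connect_in V r b x y :
  connect (third_color V r b) x y -> x != y -> (x \in V) && (y \in V).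
Proof.
move=> xy nxy; have cl : closed (third_color V r b) (pred_of_set V).
  by move=> u v /and3P[uV vV _]; rewrite uV vV.
have /= -> := closed_connect cl xy; rewrite andbb.
case/connectP: xy nxy => -[|z p] /=; first by move=> _ ->; rewrite eqxx.
case/andP=> h1 h2 -> _.
have hz : z \in V by case/and3P: h1.
by have /= <- := closed_connect cl (path_connect h2 (mem_last z p)).
Qed.

Lemma unconnected_color V r b x y :
    x \in V -> y \in V -> ~~ connect (third_color V r b) x y ->
  x != y /\ (c x y == r) || (c x y == b).
Proof.
move=> xV yV nxy; have neq : x != y by apply: contraNneq nxy => ->.
split=> //; apply: contraNT nxy; rewrite negb_or => h.
by apply: connect1; rewrite /third_color xV yV neq.
Qed.

(** Moving one end of an edge between two parts along an edge [q q'] of a third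
    colour spans a triangle with two edges coloured [r] or [b]; not being
    rainbow, these two have the same colour. *)
Lemma connected_homogeneous V r b x y z :
    x \in V -> z \in V -> connect (third_color V r b) x y ->
    ~~ connect (third_color V r b) x z ->
  c x z = c y z.
Proof.
move=> xV zV xy nxz; pose e := third_color V r b.
pose a := [pred q | connect e x q ==> (c q z == c x z)].
have cl : closed e a.
  apply: (intro_closed (third_color_connect_sym V r b)) => q q' qq'; rewrite !inE.
  have [xq /= /eqP cq|nxq _] := boolP (connect e x q); last first.
    apply/implyP => xq'; case/negP: nxq; apply: connect_trans xq' _.
    by rewrite third_color_connect_sym connect1.
  have xq' : connect e x q' := connect_trans xq (connect1 qq').
  rewrite xq' /=.
  have /and5P[qV q'V nqq' nr nb] := qq'.
  have nz w : connect e x w -> ~~ connect e w z.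
    by move=> xw; apply: contra nxz; apply: connect_trans.
  have [nqz cqz] := unconnected_color qV zV (nz _ xq).
  have [nq'z cq'z] := unconnected_color q'V zV (nz _ xq').
  rewrite -cq eq_sym; have /or3P[/eqP h|/eqP h|] := c_gallai nqq' nq'z nqz.
  - by rewrite h in nr nb; rewrite (negPf nr) (negPf nb) in cq'z.
  - by rewrite h in nr nb; rewrite (negPf nr) (negPf nb) in cqz.
  by rewrite eq_sym.
have := closed_connect cl xy.
by rewrite !inE connect0 eqxx xy /= => /esym/eqP.
Qed.

(** Gallai's theorem, by induction on [V]: remove [v] and take colours [r], [b]
    for the rest.  If [v] has no edge of a third colour to some component, then
    [r] and [b] still work.  Otherwise all third-coloured edges at [v] have one
    colour [g], because no triangle with two components is rainbow; and the
    edges at [v] coloured [r] or [b] all have the same colour, because each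
    forces its colour on the edges between two components.  So [v] sees only
    two colours and is isolated in the graph of the others. *)
Lemma gallai_disconnected V :
    1 < #|V| -> 1 < #|C| ->
  exists r b, r != b /\ exists x y, [/\ x \in V, y \in V & ~~ connect (third_color V r b) x y].
Proof.
move=> V1 C1; move Dn: #|V| => n.
elim: n V V1 Dn => [|n IH] V V1 Dn; first by rewrite Dn in V1.
have isolated v r b : v \in V -> r != b ->
    {in V, forall u, u != v -> (c v u == r) || (c v u == b)} ->
  exists r b, r != b /\ exists x y, [/\ x \in V, y \in V & ~~ connect (third_color V r b) x y].
  move=> vV nrb iso; exists r, b; split=> //.
  have /card_gt0P[u] : 0 < #|V :\ v| by move: V1; rewrite (cardsD1 v) vV.
  rewrite !inE => /andP[nuv uV]; exists v, u; split=> //.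
  have cl : closed (third_color V r b) (pred1 v).
    apply: (intro_closed (third_color_connect_sym V r b)) => x y /and5P[_ yV nxy nr nb].
    rewrite !inE => /eqP xv; rewrite xv in nxy nr nb; rewrite eq_sym in nxy.
    by have := iso y yV nxy; rewrite (negPf nr) (negPf nb).
  by apply/negP => /(closed_connect cl); rewrite !inE eqxx (negPf nuv).
have /card_gt0P[v vV] := ltnW V1.
have cV' : #|V :\ v| = n by move: Dn; rewrite (cardsD1 v) vV => -[].
have [n1|n1] := leqP n 1.
  have /cards1P[u eu] : #|V :\ v| == 1 by rewrite cV'; rewrite Dn in V1; rewrite eqn_leq n1.
  have /card_gt0P[b] : 0 < #|[set~ c v u]| by rewrite cardsC1 -ltnS prednK // ltnW.
  rewrite !inE eq_sym => nb; apply: (isolated v _ _ vV nb) => w wV nwv.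
  have : w \in V :\ v by rewrite !inE nwv.
  by rewrite eu inE => /eqP ->; rewrite eqxx.
have [r [b [nrb [x [y [xV' yV' nxy]]]]]] : exists r b, r != b /\ exists x y,
    [/\ x \in V :\ v, y \in V :\ v & ~~ connect (third_color (V :\ v) r b) x y].
  by apply: IH; rewrite ?cV'.
set V' := V :\ v in xV' yV' nxy; pose e := connect (third_color V' r b).
have V'V w : w \in V' -> w \in V by case/setD1P.
have V'v w : w \in V' -> v != w by case/setD1P; rewrite eq_sym.
have e_sym p q : e p q = e q p by apply: third_color_connect_sym.
case: (pickP (fun w => (w \in V') && [forall (z | e w z), (c v z == r) || (c v z == b)])) =>
    [w /andP[wV' /forall_inP noedge]|all_edge].
  exists r, b; split=> //; exists w, v; split=> //; first exact: V'V.
  have cl : closed (third_color V r b) (e w).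
    apply: (intro_closed (third_color_connect_sym V r b)) => p q /and5P[pV qV npq nr nb] wp.
    have pV' : p \in V'.
      by have [<-//|nwp] := eqVneq w p; have /andP[] := third_color_connect_in wp nwp.
    have nqv : q != v.
      apply: contraNneq nr => eq; have := noedge p wp.
      by rewrite c_sym -eq (negPf nb) orbF.
    apply: connect_trans wp (connect1 _).
    by rewrite /third_color pV' !inE nqv qV npq nr.
  apply/negP => h0; have h : e w w = e w v := closed_connect cl h0.
  have {h} wv : e w v by rewrite -h; apply: connect0.
  have nwv : w != v by rewrite eq_sym V'v.
  by have /andP[_] := third_color_connect_in wv nwv; rewrite !inE eqxx.
have far w : w \in V' -> exists2 z, e w z & (c v z != r) && (c v z != b).
  move=> wV'; have := all_edge w; rewrite wV' /= => /negbT.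
  by case/forall_inPn=> z wz; rewrite negb_or => h; exists z.
have e_in w z : w \in V' -> e w z -> z \in V'.
  by move=> wV' wz; have [<-//|nwz] := eqVneq w z; have /andP[] := third_color_connect_in wz nwz.
have [x0 xx0 /andP[gr gb]] := far x xV'; have [y0 yy0 /andP[gr' gb']] := far y yV'.
set g := c v x0 in gr gb.
have x0V := e_in _ _ xV' xx0; have y0V := e_in _ _ yV' yy0.
have same p q : p \in V' -> q \in V' -> ~~ e p q ->
    (c v p != r) && (c v p != b) -> (c v q != r) && (c v q != b) -> c v p = c v q.
  move=> pV qV npq /andP[pr pb] /andP[qr qb].
  have [neq cpq] := unconnected_color pV qV npq.
  have /or3P[/eqP h|/eqP//|/eqP h] := c_gallai (V'v _ pV) neq (V'v _ qV).
    by rewrite -h (negPf pr) (negPf pb) in cpq.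
  by rewrite h (negPf qr) (negPf qb) in cpq.
have nx0y0 : ~~ e x0 y0.
  apply: contra nxy => h; apply: connect_trans xx0 (connect_trans h _).
  by rewrite -/(e _ _) e_sym.
have gy0 : c v y0 = g by rewrite -(same x0 y0) ?gr ?gr'.
have farg u : exists w, [/\ w \in V', ~~ e u w & c v w = g].
  have [ux0|nux0] := boolP (e u x0); last by exists x0.
  exists y0; split=> //; apply: contra nx0y0 => uy0.
  by apply: connect_trans _ uy0; rewrite -/(e _ _) e_sym.
have tri u w : u \in V' -> w \in V' -> ~~ e u w -> c v w = g ->
    (c v u == r) || (c v u == b) -> c u w = c v u.
  move=> uV wV nuw cw cu; have [neq cuw] := unconnected_color uV wV nuw.
  have /or3P[/eqP//|/eqP h|/eqP h] := c_gallai (V'v _ uV) neq (V'v _ wV).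
    by rewrite h cw (negPf gr) (negPf gb) in cu.
  by rewrite h cw (negPf gr) (negPf gb) in cuw.
have outg u : u \in V' -> [|| c v u == g, c v u == r | c v u == b].
  move=> uV; have [//|/norP[nr nb]] := boolP ((c v u == r) || (c v u == b)).
    by rewrite orbT.
  have [w [wV nuw cw]] := farg u.
  by rewrite (same u w) ?nr ?nb ?cw ?eqxx ?gr.
have one_color u u' : u \in V' -> u' \in V' -> c v u = r -> c v u' = b -> False.
  move=> uV u'V cu cu'.
  have [uu'|nuu'] := boolP (e u u').
    have [w [wV nuw cw]] := farg u; have nu'w : ~~ e u' w.
      by apply: contra nuw; apply: connect_trans.
    have := connected_homogeneous uV wV uu' nuw.
    rewrite (tri u w) ?cu ?eqxx // (tri u' w) ?cu' ?eqxx ?orbT //.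
    by move=> h; rewrite h eqxx in nrb.
  have [z uz] := far u uV; have [z' u'z'] := far u' u'V.
  have zV := e_in _ _ uV uz; have z'V := e_in _ _ u'V u'z'.
  move=> oz' oz.
  have nzu' : ~~ e z u' by apply: contra nuu'; apply: connect_trans.
  have nuz' : ~~ e u z'.
    by apply: contra nuu' => h; apply: connect_trans h _; rewrite -/(e _ _) e_sym.
  have cg q : q \in V' -> (c v q != r) && (c v q != b) -> c v q = g.
    by move=> qV /andP[/negPf nr /negPf nb]; have := outg q qV; rewrite nr nb !orbF => /eqP.
  have h1 := connected_homogeneous uV u'V uz nuu'.
  have h2 := connected_homogeneous u'V uV u'z' (etrans (congr1 negb (e_sym u' u)) nuu').
  have t1 : c u z' = r by rewrite (tri u z') ?cu ?eqxx // (cg z').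
  have t2 : c u' z = b.
    rewrite (tri u' z) ?cu' ?eqxx ?orbT //; first by rewrite e_sym.
    by rewrite (cg z).
  move: nrb; rewrite -t1 -t2 (c_sym u z') -h2 (c_sym u' z) -h1 (c_sym u') eqxx.
  by [].
have [/existsP[u /andP[uV /eqP cu]]|/existsPn nou] := boolP [exists u, (u \in V') && (c v u == r)].
  apply: (isolated v g r vV gr) => w wV nwv; have wV' : w \in V' by rewrite !inE nwv.
  have /or3P[->|->|/eqP cw] := outg w wV'; rewrite ?orbT //.
  by case: (one_color u w).
apply: (isolated v g b vV gb) => w wV nwv; have wV' : w \in V' by rewrite !inE nwv.
have /or3P[->|cw|->] := outg w wV'; rewrite ?orbT //.
by have := nou w; rewrite wV' cw.
Qed.

End Gallai.

(** * The upper bound *)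

Section UpperBound.
Variables (T C : finType) (c : T -> T -> C).
Hypothesis c_sym : forall x y, c x y = c y x.
Hypothesis c_gallai : forall x y z, x != y -> y != z -> x != z ->
  [|| c x y == c y z, c x y == c x z | c y z == c x z].
Hypothesis C1 : 1 < #|C|.

Definition color_rel j : rel T := fun x y => c x y == j.

Lemma color_rel_sym j : symmetric (color_rel j).
Proof. by move=> x y; rewrite /color_rel c_sym. Qed.

Lemma gallai_disconnected_ordered (V : {set T}) (m : C -> nat) :
    1 < #|V| ->
  exists r b, [/\ r != b, m b <= m r
    & exists x y, [/\ x \in V, y \in V & ~~ connect (third_color c V r b) x y]].
Proof.
case/(gallai_disconnected c_sym c_gallai)=> // r [b [nrb [x [y [xV yV nxy]]]]].
have [le|/ltnW le] := leqP (m b) (m r); first by exists r, b; split=> //; exists x, y.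
exists b, r; rewrite eq_sym; split=> //; exists x, y; split=> //.
rewrite (eq_connect (e' := third_color c V r b)) // => u w.
by rewrite /third_color; congr [&& _, _, _ & _]; rewrite andbC.
Qed.

Lemma sum_two (m : C -> nat) r b : r != b ->
  \sum_j m j = m r + m b + \sum_(j | (j != r) && (j != b)) m j.
Proof.
move=> nrb; rewrite (bigD1 r) //= (bigD1 b) 1?eq_sym //= addnA.
by [].
Qed.

(* The induction step: V is a counterexample with a Gallai partition in the
   colours r and b, whose parts are the classes of sim. *)
Section OneStep.
Variables (V : {set T}) (m : C -> nat) (r b : C).
Hypotheses (nrb : r != b) (le_br : m b <= m r).
Let sim := connect (third_color c V r b).
Hypothesis noP : forall j, ~~ has_path (color_rel j) V ((m j).*2 + 3).
Hypothesis leV : 3 + \max_j m j + \sum_j m j <= #|V|.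

Let part x := [set y in V | sim x y].
Let nbr j x := [set z in V | ~~ sim x z & c x z == j].

Let part_card x : x \in V -> #|V| = #|part x| + #|nbr r x| + #|nbr b x|.
Proof.
move=> xV; have dis : [disjoint nbr r x & nbr b x].
  rewrite -setI_eq0; apply/eqP/setP => z; rewrite !inE; apply/negP.
  case/andP=> /and3P[_ _ /eqP->] /and3P[_ _]; exact/negP.
have -> : V = part x :|: (nbr r x :|: nbr b x).
  apply/setP => z; rewrite !inE; case zV: (z \in V) => //=; symmetry.
  have [//|nxz] := boolP (sim x z).
  by have [_] := unconnected_color xV zV nxz.
rewrite !cardsU -addnA; have -> : nbr r x :&: nbr b x = set0 by apply/eqP; rewrite setI_eq0.
have -> : part x :&: (nbr r x :|: nbr b x) = set0.
  by apply/setP => z; rewrite !inE; case: (sim x z); rewrite ?andbF ?andbT.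
by rewrite cards0 !subn0.
Qed.

Let nbr_complete j x : x \in V -> {in part x & nbr j x, forall a z, color_rel j a z}.
Proof.
move=> xV a z; rewrite !inE => /andP[_ xa] /and3P[zV nxz /eqP <-].
by rewrite /color_rel (connected_homogeneous c_sym c_gallai xV zV xa nxz).
Qed.

Let part_extend j x s n : x \in V ->
    path_in (color_rel j) (part x) s -> 0 < size s ->
    size s + n <= #|part x| -> n <= #|nbr j x| ->
  has_path (color_rel j) V (size s + n.*2).
Proof.
move=> xV; apply: (extend_path (color_rel_sym j) (R := nbr j x)).
- by apply/subsetP => z; rewrite inE => /andP[].
- by apply/subsetP => z; rewrite inE => /andP[].
- rewrite -setI_eq0; apply/eqP/setP => z; rewrite !inE.
  by case: (sim x z); rewrite ?andbF ?andbT.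
exact: nbr_complete.
Qed.

Let le_max j : m j <= \max_j m j. Proof. exact: leq_bigmax. Qed.

Let le_sum : m r + m b <= \sum_j m j.
Proof. by rewrite (sum_two _ nrb) leq_addr. Qed.

Let nbr_small j x :
  x \in V -> (m j).+2 <= #|part x| -> #|nbr j x| <= m j.
Proof.
move=> xV big; rewrite leqNgt; apply/negP => lt.
case/negP: (noP j); have -> : (m j).*2 + 3 = size [:: x] + (m j).+1.*2 by rewrite /=; clear; lia.
apply: (part_extend (x := x)) => //; rewrite /path_in /= andbT inE xV.
exact: connect0.
Qed.

(** A part with at least [m r + 2] vertices has at most [m r] red and [m b]
    blue neighbours.  Deleting them costs as many vertices as it lowers the
    bounds of the two colours: a red path of the part is prolonged by two
    vertices for each red neighbour of the part. *)
Lemma big_part x :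
    x \in V -> (m r).+2 <= #|part x| ->
  exists m' : C -> nat,
    [/\ forall j, ~~ has_path (color_rel j) (part x) ((m' j).*2 + 3),
        \max_j m' j <= \max_j m j
      & #|V| + \sum_j m' j = #|part x| + \sum_j m j].
Proof.
move=> xV big; have cV := part_card xV.
have nr : #|nbr r x| <= m r by apply: nbr_small.
have nb : #|nbr b x| <= m b.
  by apply: nbr_small => //; apply: leq_trans big; rewrite !ltnS.
pose m' j := if (j == r) || (j == b) then m j - #|nbr j x| else m j.
have m'r : m' r = m r - #|nbr r x| by rewrite /m' eqxx.
have m'b : m' b = m b - #|nbr b x| by rewrite /m' eqxx orbT.
exists m'; split.
- move=> j; apply/negP; rewrite /m'; case: ifP => [rb|_]; last first.
    by apply/negP; apply: contra (noP j); apply: has_path_sub => //; apply/subsetP => z; rewrite inE => /andP[].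
  have nj : #|nbr j x| <= m j by case/orP: rb => /eqP->.
  case/has_pathP=> s sP sz; case/negP: (noP j).
  have -> : (m j).*2 + 3 = size s + (#|nbr j x|).*2.
    by move: nj; rewrite sz; clear; lia.
  apply: (part_extend xV sP); rewrite // sz; first by rewrite addn3.
  have le_j : m j <= m r by case/orP: rb => /eqP->.
  have := le_max r; have := le_sum; move: leV nr nb nj le_j le_br cV.
  case/orP: rb => /eqP->; clear; lia.
- apply/bigmax_leqP => j _; apply: leq_trans (le_max j).
  by rewrite /m'; case: ifP => // _; apply: leq_subr.
rewrite !(sum_two _ nrb) m'r m'b cV.
have -> : \sum_(j | (j != r) && (j != b)) m' j = \sum_(j | (j != r) && (j != b)) m j.
  by apply: eq_bigr => j /andP[/negPf nr' /negPf nb']; rewrite /m' nr' nb'.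
by move: nr nb; clear; lia.
Qed.

(** Parts with at most [m r + 1] vertices have more than [m b] blue or more
    than [m r] red neighbours.  Colouring the inside of each part blue in the
    first case and red in the second yields a two-coloured complete graph, and
    the long path it contains can avoid the recoloured edges. *)
Lemma not_all_parts_small : {in V, forall x, #|part x| <= (m r).+1} -> False.
Proof.
move=> small.
pose good j : rel T := fun x y => [&& x \in V, y \in V, ~~ sim x y & c x y == j].
pose tyb := [pred x | m b < #|nbr b x|].
pose tyr := predC tyb.
have sim_sym : symmetric sim by move=> x y; apply: third_color_connect_sym.
have sim_in x y : sim x y -> (x \in V) = (y \in V).
  have [->//|nxy] := eqVneq x y => xy.
  by have /andP[-> ->] := third_color_connect_in xy nxy.
have sim_eq x y z : sim x y -> sim x z = sim y z.
  move=> xy; apply/idP/idP; last exact: connect_trans.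
  by apply: connect_trans; rewrite -/(sim _ _) sim_sym.
have good_sym j : symmetric (good j).
  by move=> x y; rewrite /good sim_sym c_sym andbCA.
have goodN j x y : good j x y -> ~~ sim x y by case/and4P.
have good_sim j x y z : sim x y -> good j x z = good j y z.
  move=> xy; rewrite /good (sim_in _ _ xy) (sim_eq _ _ z xy).
  case yV: (y \in V) => //=; case zV: (z \in V) => //=.
  have [//|nyz] := boolP (sim y z).
  have xV : x \in V by rewrite (sim_in _ _ xy).
  have nxz : ~~ sim x z by rewrite (sim_eq _ _ z xy).
  by rewrite (connected_homogeneous c_sym c_gallai xV zV xy nxz).
have nbrE j x : x \in V -> [set z in V | good j x z] = nbr j x.
  by move=> xV; apply/setP => z; rewrite !inE /good xV; case: (z \in V).
have tyb_sim x y : sim x y -> tyb x = tyb y.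
  move=> xy /=; have [<-//|nxy] := eqVneq x y.
  have /andP[xV yV] := third_color_connect_in xy nxy.
  rewrite -!nbrE //; congr (_ < #|pred_of_set _|).
  by apply/setP => z; rewrite !inE (good_sim _ _ _ _ xy).
have tyr_sim x y : sim x y -> tyr x = tyr y by move=> xy; congr (~~ _); apply: tyb_sim.
have bigb x : x \in V -> tyb x -> m b < #|[set z in V | good b x z]|.
  by move=> xV; rewrite nbrE.
have bigr x : x \in V -> tyr x -> m r < #|[set z in V | good r x z]|.
  move=> xV; rewrite nbrE //= -leqNgt => nb.
  have := le_max r; have := le_sum; move: leV (small x xV) nb (part_card xV).
  by clear; lia.
have sub_good j : subrel (good j) (color_rel j) by move=> x y /and4P[].
have absorbed (ty : pred T) j : (forall x y, sim x y -> ty x = ty y) ->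
    (forall x, x \in V -> ty x -> m j < #|[set z in V | good j x z]|) ->
    has_path (recolored (good j) sim ty) V ((m j).*2 + 3) -> False.
  move=> ty_sim ty_big h; case/negP: (noP j).
  apply: (has_path_sub (e := good j)) => //; first by move=> x y _ _; apply: sub_good.
  exact: (inside_edges_removable (good_sym j) (fun x => connect0 _ x) sim_sym (goodN j) (good_sim j) ty_sim ty_big h).
have : has_path (recolored (good r) sim tyr) V ((m r).*2 + 3)
    || has_path (recolored (good b) sim tyb) V ((m b).*2 + 3).
  apply: two_color_paths => //; last 1 first.
  - by have := le_max r; have := le_sum; move: leV; clear; lia.
  - exact: recolored_sym.
  - exact: recolored_sym.
  move=> x y xV yV nxy; rewrite /recolored /good xV yV nxy /=.
  have [xy|nxy'] := boolP (sim x y); first by rewrite /= orNb.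
  by have [_] := unconnected_color xV yV nxy'; rewrite !orbF.
by case/orP; apply: absorbed.
Qed.

End OneStep.

Theorem gallai_paths_upper (V : {set T}) (m : C -> nat) :
    (forall j, ~~ has_path (color_rel j) V ((m j).*2 + 3)) ->
  #|V| < 3 + \max_j m j + \sum_j m j.
Proof.
have [n] := ubnP #|V|; elim: n V m => // n IH V m lt_n noP.
rewrite ltnNge; apply/negP => leV.
have V1 : 1 < #|V| by apply: leq_trans leV; rewrite -addnA ltn_addr.
have [r [b [nrb le_br [x [y [xV yV nxy]]]]]] := gallai_disconnected_ordered m V1.
apply: (not_all_parts_small nrb le_br noP leV) => z zV; rewrite leqNgt; apply/negP => big.
have [m' [noP' le_max eV]] := big_part nrb le_br noP leV zV big.
set A := [set _ in V | _] in big noP' eV.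
have ltA : #|A| < #|V|.
  apply: proper_card; apply/properP; split.
    by apply/subsetP => w; rewrite inE => /andP[].
  have [zx|nzx] := boolP (connect (third_color c V r b) z x); last first.
    by exists x; rewrite // inE (negPf nzx) andbF.
  exists y; rewrite // inE yV /=; apply: contra nxy; apply: connect_trans.
  by rewrite third_color_connect_sym.
have := IH A m' (leq_trans ltA lt_n) noP'.
by move: le_max eV leV; clear; lia.
Qed.

End UpperBound.

(** * Gallai-Ramsey numbers of odd paths *)

Lemma path_graph_copy N k (c : edge_coloring N k) j n :
    has_path (fun x y => c [set x; y] == j) setT n ->
  monochromatic_copy c (path_graph n) j.
Proof.
case/existsP=> t /and3P[/tuple_uniqP t_inj t_sorted _].
exists (tnth t) => // u v; have x0 := tnth t u.
have step (a b : 'I_n) : a.+1 = b -> c [set tnth t a; tnth t b] = j.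
  move=> ab; rewrite !(tnth_nth x0) -ab; apply/eqP.
  by apply: (sortedP x0 t_sorted); rewrite size_tuple ab.
by case/orP=> /eqP uv; [|rewrite setUC]; apply: step.
Qed.

(** Gallai's theorem is applied with two distinct colours, so for the sake of
    [k = 1] an extra colour [ord0] is added, with bound 0. *)
Theorem gallai_paths_property k (m : 'I_k -> nat) :
    0 < k ->
  gallai_ramsey_property (fun j => path_graph (2 * m j + 3))
    (3 + \max_(j < k) m j + \sum_(j < k) m j).
Proof.
move=> k0; set N := (_ + _ + _) => c cG.
pose d (x y : 'I_N) : 'I_k.+1 := lift ord0 (c [set x; y]).
pose m' (j : 'I_k.+1) := if unlift ord0 j is Some i then m i else 0.
have m'0 : m' ord0 = 0 by rewrite /m' unlift_none.
have m'L i : m' (lift ord0 i) = m i by rewrite /m' liftK.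
have d_sym x y : d x y = d y x by rewrite /d setUC.
have d_gallai x y z : x != y -> y != z -> x != z ->
    [|| d x y == d y z, d x y == d x z | d y z == d x z].
  move=> xy yz xz; have := cG x y z; rewrite /rainbow_triangle /= !inE !negb_or xy yz xz /=.
  by rewrite !(inj_eq lift_inj) andbT -!negb_or negbK orbA.
have C1 : 1 < #|'I_k.+1| by rewrite card_ord ltnS.
have [/forallP noP|] := boolP [forall j, ~~ has_path (color_rel d j) setT ((m' j).*2 + 3)].
  have := gallai_paths_upper d_sym d_gallai C1 noP.
  rewrite cardsT card_ord !big_ord_recl m'0 max0n add0n.
  under eq_bigr do rewrite m'L.
  under [X in _ < _ + X]eq_bigr do rewrite m'L.
  by rewrite ltnn.
rewrite negb_forall => /existsP[j]; rewrite negbK.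
case: (unliftP ord0 j) => [i ->|->]; last first.
  rewrite m'0 => /existsP[t /and3P[_ st _]]; exfalso.
  by case: t st => -[|x [|y s]] //= _; rewrite /color_rel /d => /andP[].
rewrite m'L => h; exists i; rewrite mul2n; apply: path_graph_copy.
apply: has_path_sub h => // x y _ _ /eqP /lift_inj ->; exact: eqxx.
Qed.

Section LowerBound.
Variables (k : nat) (m : 'I_k -> nat) (j0 : 'I_k).

(** The extremal colouring gives an edge the colour listed here at its larger
    end: a clique on [2 * m j0 + 2] vertices, then for every other colour [m j]
    vertices joined in that colour to everything before them. *)
Definition layers : seq 'I_k :=
  nseq (m j0).*2.+2 j0 ++ flatten [seq nseq (m j) j | j <- enum 'I_k & j != j0].

Lemma size_layers : size layers = 2 + m j0 + \sum_j m j.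
Proof.
rewrite size_cat size_nseq size_flatten /shape -map_comp sumnE big_map big_filter.
rewrite big_enum_cond /= [in RHS](bigD1 j0) //=.
rewrite (eq_bigr m); last by move=> j _; rewrite size_nseq.
by rewrite addnA -(addnA 2) addnn.
Qed.

Lemma count_layers j : j != j0 -> count_mem j layers = m j.
Proof.
move=> nj; rewrite count_cat count_nseq /= eq_sym (negPf nj) mul0n add0n.
rewrite count_flatten -map_comp sumnE big_map big_filter big_enum_cond (bigD1 j) //=.
rewrite count_nseq /= eqxx mul1n big1 ?addn0 // => i /andP[_ nij].
by rewrite /= count_nseq /= (negPf nij).
Qed.

Lemma nth_layers n :
  n < size layers -> nth j0 layers n = j0 -> n < (m j0).*2.+2.
Proof.
move=> lt; apply: contra_eqT; rewrite -leqNgt => le.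
have : nth j0 layers n \in flatten [seq nseq (m j) j | j <- enum 'I_k & j != j0].
  rewrite nth_cat size_nseq ltnNge le /= mem_nth //.
  by rewrite -(ltn_add2l (m j0).*2.+2) subnKC //; move: lt; rewrite size_cat size_nseq.
case/flatten_mapP=> j; rewrite mem_filter => /andP[nj _].
by rewrite mem_nseq => /andP[_ /eqP->].
Qed.

Definition layer_coloring N : edge_coloring N k :=
  fun S => nth j0 layers (\max_(x in S) x).

Lemma layer_coloring2 N (x y : 'I_N) :
  layer_coloring [set x; y] = nth j0 layers (maxn x y).
Proof.
rewrite /layer_coloring; congr nth; have [->|nxy] := eqVneq x y.
  by rewrite setUid big_set1 maxnn.
by rewrite big_setU1 ?inE //= big_set1.
Qed.

(** The two edges of a triangle at its largest vertex have the same colour. *)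
Lemma layer_coloring_gallai N : gallai_coloring (@layer_coloring N).
Proof.
move=> x y z; rewrite /rainbow_triangle !layer_coloring2; apply/negP => /andP[_] /=.
rewrite !inE !negb_or andbT => /andP[/andP[nxy nxz] nyz].
have : [|| maxn x y == maxn y z, maxn x y == maxn x z | maxn y z == maxn x z].
  by clear; move: (nat_of_ord x) (nat_of_ord y) (nat_of_ord z) => a b d; lia.
by case/or3P=> /eqP e; [move: nxy|move: nxz|move: nyz]; rewrite e eqxx.
Qed.

(** Edges of colour [j0] stay in the first clique, which is too small for the
    path.  For [j != j0] the [m j + 1] disjoint edges at positions [2t, 2t + 1]
    of the path have distinct larger ends, all among the [m j] vertices of
    layer [j]. *)
Lemma layer_coloring_free N j :
    N <= size layers ->
  ~ monochromatic_copy (@layer_coloring N) (path_graph (2 * m j + 3)) j.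
Proof.
move=> leN [f f_inj f_adj]; set l := 2 * m j + 3 in f f_inj f_adj.
(* The vertex of the path at position t, 0 being a default value. *)
pose v t := if insub t is Some u then nat_of_ord (f (u : 'I_l)) else 0.
have vE t (lt : t < l) : v t = f (Ordinal lt) by rewrite /v insubT.
have v_inj t u : t < l -> u < l -> v t = v u -> t = u.
  by move=> lt lu; rewrite (vE _ lt) (vE _ lu) => /val_inj/f_inj[].
have v_lt t : t < l -> v t < size layers.
  by move=> lt; rewrite vE (leq_trans _ leN).
have v_adj t : t.+1 < l -> nth j0 layers (maxn (v t) (v t.+1)) = j.
  move=> lt; rewrite (vE _ lt) (vE _ (ltnW lt)) -layer_coloring2.
  by apply: f_adj; rewrite /= /path_adj /= eqxx.
have [ej|nj] := eqVneq j j0.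
  have v_small t : t < l -> v t < (m j0).*2.+2.
    case: t => [|t] lt.
      have lt1 : 1 < l by rewrite /l addn3.
      apply: leq_ltn_trans (leq_maxl _ (v 1)) _; apply: nth_layers; last by rewrite v_adj.
      by rewrite gtn_max !v_lt.
    apply: leq_ltn_trans (leq_maxr (v t) _) _; apply: nth_layers; last by rewrite v_adj.
    by rewrite gtn_max !v_lt // ltnW.
  have u_v : uniq [seq v t | t <- iota 0 l].
    by rewrite map_inj_in_uniq ?iota_uniq // => t u; rewrite !mem_iota; apply: v_inj.
  have /(uniq_leq_size u_v) : {subset [seq v t | t <- iota 0 l] <= iota 0 (m j0).*2.+2}.
    by move=> _ /mapP[t + ->]; rewrite !mem_iota /= !add0n; apply: v_small.
  by rewrite size_map !size_iota /l ej mul2n addn3 ltnn.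
pose w t := maxn (v t.*2) (v t.*2.+1).
have w_dom t : t < (m j).+1 -> t.*2 < l /\ t.*2.+1 < l.
  by rewrite /l; clear; lia.
have w_inj t u : t < (m j).+1 -> u < (m j).+1 -> w t = w u -> t = u.
  move=> /w_dom[t0 t1] /w_dom[u0 u1]; rewrite /w /maxn.
  by case: ifP => _; case: ifP => _ /v_inj h; have := h _ _; clear h => h;
     have {h} := h ltac:(assumption) ltac:(assumption); clear; lia.
have u_w : uniq [seq w t | t <- iota 0 (m j).+1].
  by rewrite map_inj_in_uniq ?iota_uniq // => t u; rewrite !mem_iota; apply: w_inj.
have /(uniq_leq_size u_w) : {subset [seq w t | t <- iota 0 (m j).+1]
    <= [seq n <- iota 0 (size layers) | nth j0 layers n == j]}.
  move=> _ /mapP[t + ->]; rewrite mem_iota => /w_dom[t0 t1].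
  by rewrite mem_filter mem_iota /= add0n v_adj // eqxx gtn_max !v_lt.
rewrite size_map size_iota size_filter.
have -> : count (fun n => nth j0 layers n == j) (iota 0 (size layers)) = count_mem j layers.
  by rewrite -[X in _ = count_mem _ X](mkseq_nth j0) count_map.
by rewrite count_layers // ltnn.
Qed.

End LowerBound.

Theorem corollary1p10 (k : nat) (hk : 1 <= k) (i : 'I_k -> 'I_6) :
  is_gallai_ramsey_number
    (fun j : 'I_k => path_graph (2 * i j + 3))
    (3 + \max_(j < k) i j + \sum_(j < k) i j).
Proof.
split; first exact: gallai_paths_property.
move=> M prop_M; rewrite leqNgt; apply/negP => lt_M.
have k_gt0 : 0 < #|'I_k| by rewrite card_ord.
have [j0 max_i] := eq_bigmax (fun j => nat_of_ord (i j)) k_gt0.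
have [j] := prop_M _ (@layer_coloring_gallai k (fun j => i j) j0 M).
apply: layer_coloring_free; rewrite size_layers -max_i.
by rewrite -ltnS -!addSn in lt_M *.
Qed.
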